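(* Suppose that the normalized random sampling matrix $\widetilde R\in\mathbb R^{(m+1)\times(N+1)}$ (defined in the context) satisfies $$\sqrt{1-\epsilon}\ \le\ \sigma_{|\mathcal T|}(\widetilde R_{\mathcal T})\ \le\ \sigma_1(\widetilde R_{\mathcal T})\ \le\ \sqrt{1+\epsilon}$$ simultaneously for all nonempty subsets $\mathcal T\subset[N]$ having $|\mathcal T|\le s$, with $\epsilon=3/5$. Let $\delta\in\mathbb R^+$, and let $\mathcal S\subset[N]$ have cardinality $|\mathcal S|=s$. Then approximately solving the least squares problem $$\mathbf z_{\min}:=\operatorname*{arg\,min}_{\mathbf w\in\mathbb R^{|\mathcal S|}}\left\|\widetilde R_{\mathcal S}\mathbf w-\mathbf y\right\|_2$$ can produce an $s$-sparse vector $\mathbf z\in\mathbb R^{N+1}$ satisfying $$\left\|\tilde{\mathbf f}-\mathbf z\right\|_2\ \le\ 5\left\|\tilde{\mathbf f}_{\mathcal S^c}\right\|_2+\frac{4\left\|\tilde{\mathbf f}_{\mathcal S^c}\right\|_1}{\sqrt s}+\sqrt{\frac52}\,\delta$$ in $\mathcal O\left(s^2\ln^4(N)\cdot\ln\left(\frac{\|\tilde{\mathbf f}\|_1}{\delta}\right)\right)$-time.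
   Context: $[N]:=\{0,\dots,N\}$ and $s\in[N]\setminus\{0\}$. $L_n$ denotes the Legendre polynomial of degree $n$, and $f(x)=\sum_{n=0}^N\tilde f(n)L_n(x)$ is a real polynomial on $[-1,1]$ with Legendre coefficients $\tilde f(n)=\left(n+\frac12\right)\int_{-1}^1f(x)L_n(x)\,dx$ and coefficient vector $\tilde{\mathbf f}=(\tilde f(0),\dots,\tilde f(N))^T$. Put $Q_n(x):=\left(\frac\pi2\right)^{1/2}(1-x^2)^{1/4}L_n(x)$. The random sampling matrix $R\in\mathbb R^{(m+1)\times(N+1)}$ has entries $R_{i,j}=Q_j(x_i)$, where the $m+1$ points $x_0,\dots,x_m\in[-1,1]$ are drawn independently according to the Chebyshev measure $\pi^{-1}(1-x^2)^{-1/2}dx$, and $\widetilde R:=\frac1{\sqrt{m+1}}R$. Here $m=C's\ln^4(N)$ for an appropriate fixed universal constant $C'\in\mathbb R^+$. The vector $\mathbf y\in\mathbb R^{m+1}$ of reweighted samples of $f$ is $$y_j=(\widetilde R\tilde{\mathbf f})_j=\frac{\sqrt\pi(1-x_j^2)^{1/4}}{\sqrt{2(m+1)}}f(x_j).$$ $\widetilde R$, $\mathbf y$ and $\mathcal S$ are available to the procedure. The least squares problem is solved approximately by a conjugate gradient method, and the resulting vector in $\mathbb R^{|\mathcal S|}$ is extended by zeros outside $\mathcal S$ to give $\mathbf z$. For a matrix $X$, $X_{\mathcal T}$ is the submatrix of the columns indexed by $\mathcal T$, and $\sigma_1(X)\ge\sigma_2(X)\ge\cdots$ are the singular values. For a vector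 $\mathbf x$, $\mathbf x_{\mathcal T}$ agrees with $\mathbf x$ on $\mathcal T$ and is zero elsewhere. $\mathcal S^c=[N]\setminus\mathcal S$. A vector is $s$-sparse if it has at most $s$ nonzero entries.
   Formalization: In the time bound, ln(N) and ln(‖f̃‖₁/δ) are replaced by max(1, ln ·), since the literal bound is 0 for N = 1 and nonpositive for ‖f̃‖₁ ≤ δ; m is C's ln⁴(N) rounded to a neighbouring integer, and time counts unit-cost real operations with z given by its entries on S. *)

(* Defs.v *)
From HB Require Import structures.
From mathcomp Require Import all_boot all_order all_algebra.
From mathcomp Require Import all_classical all_reals all_analysis.

Set Implicit Arguments.
Unset Strict Implicit.
Unset Printing Implicit Defensive.

Import Order.TTheory GRing.Theory Num.Theory.
Import numFieldNormedType.Exports.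

Local Open Scope classical_set_scope.
Local Open Scope ring_scope.

Section Vectors.
Variable R : realType.

Definition norm2 n (v : 'cV[R]_n) : R := Num.sqrt (\sum_i v i 0 ^+ 2).

Definition norm1 n (v : 'cV[R]_n) : R := \sum_i `|v i 0|.

Definition sparse (s n : nat) (v : 'cV[R]_n) : Prop :=
  (#|[pred i | (v i 0 != 0)%R]| <= s)%N.

Definition restrict_to n (T : {set 'I_n}) (v : 'cV[R]_n) : 'cV[R]_n :=
  \col_i (if i \in T then v i 0 else 0).

(* Columns indexed by T, in increasing order of the index. *)
Definition cols m n (T : {set 'I_n}) (X : 'M[R]_(m, n)) : 'M[R]_(m, #|T|) :=
  colsub (fun j : 'I_#|T| => enum_val j) X.

(* Extension by zeros outside T; coordinate j of w sits at the j-th index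
   of T, matching [cols]. *)
Definition zero_extend n (T : {set 'I_n}) (w : 'cV[R]_#|T|) : 'cV[R]_n :=
  \col_i \sum_(j < #|T| | enum_val j == i) w j 0.

(* The singular values of X are the square roots of the eigenvalues of X^T X,
   repeated with (algebraic) multiplicity and in nonincreasing order. *)
Definition is_singular_values m n (X : 'M[R]_(m, n)) (l : seq R) : Prop :=
  [/\ sorted >=%R l, all (>= 0) l
    & char_poly (X^T *m X) = \prod_(a <- l) ('X - (a ^+ 2)%:P)].

Definition singular_values m n (X : 'M[R]_(m, n)) : seq R :=
  xget [::] [set l | is_singular_values X l].

(* sigma k X is the k-th largest singular value, counted from k = 1. *)
Definition sigma (k : nat) m n (X : 'M[R]_(m, n)) : R :=
  nth 0 (singular_values X) k.-1.

Definition uniform_sv_bounds m n (eps : R) (s : nat) (X : 'M[R]_(m, n)) : Prop :=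
  forall T : {set 'I_n}, T != finset.set0 -> (#|T| <= s)%N ->
    [/\ Num.sqrt (1 - eps) <= sigma #|T| (cols T X),
        sigma #|T| (cols T X) <= sigma 1 (cols T X)
      & sigma 1 (cols T X) <= Num.sqrt (1 + eps)].

Definition lsq_argmin m n (A : 'M[R]_(m, n)) (b : 'cV[R]_m) (z : 'cV[R]_n) :
    Prop :=
  forall w : 'cV[R]_n, norm2 (A *m z - b) <= norm2 (A *m w - b).

End Vectors.

Section Legendre.
Variable R : realType.

(* Rodrigues' formula. *)
Definition legendre (n : nat) : {poly R} :=
  (2 ^+ n * n`!%:R)^-1 *: (('X^2 - 1) ^+ n)^`(n).

Definition legendre_coef (f : {poly R}) (n : nat) : R :=
  (n%:R + 2^-1) *
  \int[lebesgue_measure]_(x in `[-1, 1]) (f.[x] * (legendre n).[x]).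

Definition coef_vector (N : nat) (f : {poly R}) : 'cV[R]_N.+1 :=
  \col_n legendre_coef f n.

Definition legendreQ (n : nat) (x : R) : R :=
  Num.sqrt (pi / 2) * (1 - x ^+ 2) `^ (4^-1) * (legendre n).[x].

Definition sampling_matrix (N m : nat) (x : 'I_m.+1 -> R) : 'M[R]_(m.+1, N.+1) :=
  \matrix_(i, j) legendreQ j (x i).

Definition normalized_sampling_matrix (N m : nat) (x : 'I_m.+1 -> R) :
    'M[R]_(m.+1, N.+1) :=
  (Num.sqrt m.+1%:R)^-1 *: sampling_matrix N x.

Definition weighted_samples (m : nat) (x : 'I_m.+1 -> R) (f : {poly R}) :
    'cV[R]_m.+1 :=
  \col_j (Num.sqrt pi * (1 - x j ^+ 2) `^ (4^-1) / Num.sqrt (2 * m.+1%:R)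
          * f.[x j]).

End Legendre.

Section Sampling.
Context (d : measure_display) (Omega : measurableType d) (R : realType)
  (P : probability Omega R).

Definition mutually_independent (I : finType) (X : I -> {RV P >-> R}) : Prop :=
  forall (J : {set I}) (B : I -> set R), (forall i, measurable (B i)) ->
    (P (\bigcap_(i in [set i | i \in J]) (X i @^-1` B i)) =
     \prod_(i in J) P (X i @^-1` B i))%E.

Definition chebyshev_distributed (X : {RV P >-> R}) : Prop :=
  forall B : set R, measurable B ->
    (distribution P X B =
     \int[lebesgue_measure]_(x in B `&` `[(-1)%R, 1%R])
       (pi^-1 * (1 - x ^+ 2) `^ (- 2^-1))%:E)%E.

End Sampling.

(* Real-number RAM with unit costs: [Timed A] pairs a result with the number of
   elementary steps spent on it. Real arithmetic operations, comparisons and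
   stores into memory cost one step each; fetching operands is part of the
   operation that uses them. *)
Section Timed.

Definition Timed (A : Type) : Type := (A * nat)%type.

Definition ret (A : Type) (a : A) : Timed A := (a, 0%N).

Definition bind (A B : Type) (x : Timed A) (k : A -> Timed B) : Timed B :=
  ((k x.1).1, (x.2 + (k x.1).2)%N).

(* [while_run guard body st (st', c)]: the loop "while guard do body" started in
   state st terminates in state st' after c steps. *)
Inductive while_run (St : Type) (guard : St -> Timed bool)
    (body : St -> Timed St) : St -> Timed St -> Prop :=
| while_stop st :
    (guard st).1 = false -> while_run guard body st (st, (guard st).2)
| while_step st st' c :
    (guard st).1 = true -> while_run guard body (body st).1 (st', c) ->
    while_run guard body st (st', ((guard st).2 + (body st).2 + c)%N).

End Timed.

Notation "'let*' x := e 'in' k" := (bind e (fun x => k))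
  (at level 200, x name, k at level 200, right associativity).

Section ConjugateGradient.
Variable R : realType.

Definition op_add (x y : R) : Timed R := (x + y, 1%N).
Definition op_sub (x y : R) : Timed R := (x - y, 1%N).
Definition op_mul (x y : R) : Timed R := (x * y, 1%N).
Definition op_div (x y : R) : Timed R := (x / y, 1%N).
Definition op_lt (x y : R) : Timed bool := (x < y, 1%N).

Definition store n (F : 'I_n -> Timed R) : Timed 'cV[R]_n :=
  (\col_i (F i).1, (\sum_(i < n) (F i).2.+1)%N).

(* One addition is charged for each summand. *)
Definition sum_up n (F : 'I_n -> Timed R) : Timed R :=
  (\sum_i (F i).1, (\sum_(i < n) (F i).2.+1)%N).

Definition dot n (u v : 'cV[R]_n) : Timed R :=
  sum_up (fun i => op_mul (u i 0) (v i 0)).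

Definition apply_mx m n (A : 'M[R]_(m, n)) (v : 'cV[R]_n) : Timed 'cV[R]_m :=
  store (fun i => sum_up (fun j => op_mul (A i j) (v j 0))).

Definition apply_trmx m n (A : 'M[R]_(m, n)) (v : 'cV[R]_m) : Timed 'cV[R]_n :=
  store (fun j => sum_up (fun i => op_mul (A i j) (v i 0))).

(* u + a v and u - a v *)
Definition axpy n (u : 'cV[R]_n) (a : R) (v : 'cV[R]_n) : Timed 'cV[R]_n :=
  store (fun i => let* t := op_mul a (v i 0) in op_add (u i 0) t).
Definition axmy n (u : 'cV[R]_n) (a : R) (v : 'cV[R]_n) : Timed 'cV[R]_n :=
  store (fun i => let* t := op_mul a (v i 0) in op_sub (u i 0) t).

(* Invariants: res = b - A sol and gamma = ||A^T res||^2. *)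
Record cg_state (m n : nat) := CGState {
  sol : 'cV[R]_n;
  res : 'cV[R]_m;
  dir : 'cV[R]_n;
  gamma : R
}.

Definition cg_init m n (A : 'M[R]_(m, n)) (b : 'cV[R]_m) :
    Timed (cg_state m n) :=
  let* x := store (fun _ => ret 0) in
  let* r := store (fun i => ret (b i 0)) in
  let* g := apply_trmx A r in
  let* c := dot g g in
  ret (CGState x r g c).

(* A step of the Hestenes-Stiefel conjugate gradient method for the normal
   equations A^T A w = A^T b (CGLS). *)
Definition cg_step m n (A : 'M[R]_(m, n)) (st : cg_state m n) :
    Timed (cg_state m n) :=
  let* q := apply_mx A (dir st) in
  let* qq := dot q q in
  let* alpha := op_div (gamma st) qq in
  let* x := axpy (sol st) alpha (dir st) in
  let* r := axmy (res st) alpha q in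
  let* g := apply_trmx A r in
  let* c := dot g g in
  let* beta := op_div c (gamma st) in
  let* p := axpy g beta (dir st) in
  ret (CGState x r p c).

(* [cgls_run A b eps delta (w, c)]: the method, started at 0, terminates with
   the vector w after c steps. It stops as soon as
   ||A^T (b - A w)||^2 <= (1 - eps) delta^2; if the smallest singular value of A
   is at least sqrt (1 - eps), then the distance of A w to the orthogonal
   projection of b onto the range of A is at most delta. *)
Definition cgls_run m n (A : 'M[R]_(m, n)) (b : 'cV[R]_m) (eps delta : R)
    (out : Timed 'cV[R]_n) : Prop :=
  let setup :=
    let* e := op_sub 1 eps in
    let* d2 := op_mul delta delta in
    let* tau := op_mul e d2 in
    let* st := cg_init A b in
    ret (tau, st) in
  exists (st : cg_state m n) (c : nat),
    while_run (fun st => op_lt setup.1.1 (gamma st)) (cg_step A) setup.1.2 (st, c)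
    /\ out = (sol st, (setup.2 + c)%N).

End ConjugateGradient.

(* Logarithm inside asymptotic bounds: bounded below by 1, since ln N vanishes
   for N = 1 and ln (||f||_1 / delta) can be arbitrarily small or negative. *)
Definition ln_max1 (R : realType) (x : R) : R := Num.max 1 (ln x).

(* Main.v *)
(** Write A for the columns of the sampling matrix indexed by S, G = A^T A, and z
    for the solution of the normal equations. The singular value hypothesis says
    that the spectrum of G lies in [2/5, 8/5].

    Error. The samples are y = A f_S + r with r the image of the tail f_{S^c}, and
    ||A (f_S - z)|| <= ||r|| by orthogonality. Cutting the tail into blocks of s
    coefficients of decreasing magnitude gives
    ||r|| <= sqrt (8/5) (||f_{S^c}||_2 + ||f_{S^c}||_1 / sqrt s).

    Time. In a conjugate gradient step the new direction p is G-conjugate to the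
    previous one and differs from the gradient g by a multiple of it, so
    ||A p|| <= ||A g||. The exact line search along p therefore decreases the
    energy ||A (z - w)||^2 at least as much as steepest descent, i.e. by a factor
    1 - (2/5) / (8/5) = 3/4, and the stopping test succeeds after O(ln (||f||_1 /
    delta)) steps of cost O(m s). *)

Require Import Defs.
From HB Require Import structures.
From mathcomp Require Import all_boot all_order all_algebra.
From mathcomp Require Import all_classical all_reals all_analysis.
From mathcomp Require Import ring lra zify complex.

Set Implicit Arguments.
Unset Strict Implicit.
Unset Printing Implicit Defensive.

Import Order.TTheory GRing.Theory Num.Theory.
Import numFieldNormedType.Exports.

Local Open Scope ring_scope.

(** * Inner product and quadratic forms *)

Section InnerProduct.
Variable R : realType.
Implicit Types n : nat.

Definition ip n (u v : 'cV[R]_n) : R := \sum_i u i 0 * v i 0.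

Lemma ipE n (u v : 'cV[R]_n) : ip u v = (u^T *m v) 0 0.
Proof. by rewrite mxE; apply: eq_bigr => i _; rewrite mxE. Qed.

Lemma ipC n (u v : 'cV[R]_n) : ip u v = ip v u.
Proof. by apply: eq_bigr => i _; rewrite mulrC. Qed.

Lemma ipDl n (u v w : 'cV[R]_n) : ip (u + v) w = ip u w + ip v w.
Proof. by rewrite -big_split; apply: eq_bigr => i _; rewrite mxE mulrDl. Qed.

Lemma ipZl n a (u v : 'cV[R]_n) : ip (a *: u) v = a * ip u v.
Proof. by rewrite mulr_sumr; apply: eq_bigr => i _; rewrite mxE mulrA. Qed.

Lemma ipNl n (u v : 'cV[R]_n) : ip (- u) v = - ip u v.
Proof. by rewrite -scaleN1r ipZl mulN1r. Qed.

Lemma ipBl n (u v w : 'cV[R]_n) : ip (u - v) w = ip u w - ip v w.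
Proof. by rewrite ipDl ipNl. Qed.

Lemma ipDr n (u v w : 'cV[R]_n) : ip w (u + v) = ip w u + ip w v.
Proof. by rewrite !(ipC w) ipDl. Qed.

Lemma ipZr n a (u v : 'cV[R]_n) : ip u (a *: v) = a * ip u v.
Proof. by rewrite !(ipC u) ipZl. Qed.

Lemma ipNr n (u v : 'cV[R]_n) : ip u (- v) = - ip u v.
Proof. by rewrite !(ipC u) ipNl. Qed.

Lemma ipBr n (u v w : 'cV[R]_n) : ip w (u - v) = ip w u - ip w v.
Proof. by rewrite ipDr ipNr. Qed.

Lemma ip0l n (u : 'cV[R]_n) : ip 0 u = 0.
Proof. by rewrite -(scale0r 0) ipZl mul0r. Qed.

Lemma ip0r n (u : 'cV[R]_n) : ip u 0 = 0.
Proof. by rewrite ipC ip0l. Qed.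

Lemma ip_ge0 n (u : 'cV[R]_n) : 0 <= ip u u.
Proof. by apply: sumr_ge0 => i _; rewrite -expr2 sqr_ge0. Qed.

Lemma ip_eq0 n (u : 'cV[R]_n) : ip u u = 0 -> u = 0.
Proof.
move=> u0; apply/colP => i; rewrite mxE; apply/eqP; rewrite -sqrf_eq0 expr2.
by apply/eqP; apply: (psumr_eq0P _ u0) => // j _; rewrite -expr2 sqr_ge0.
Qed.

Lemma ip_pythagoras n (u v : 'cV[R]_n) :
  ip u v = 0 -> ip (u + v) (u + v) = ip u u + ip v v.
Proof. by move=> uv; rewrite !(ipDl, ipDr) (ipC v u) uv addr0 add0r. Qed.

Lemma ip_mull m n (A : 'M[R]_(m, n)) u v : ip (A *m u) v = ip u (A^T *m v).
Proof. by rewrite !ipE trmx_mul mulmxA. Qed.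

Lemma ip_trmull m n (A : 'M[R]_(m, n)) u v : ip (A^T *m u) v = ip u (A *m v).
Proof. by rewrite ip_mull trmxK. Qed.

Lemma cauchy_schwarz n (u v : 'cV[R]_n) : ip u v ^+ 2 <= ip u u * ip v v.
Proof.
have [v0|v0] := eqVneq (ip v v) 0.
  by rewrite (ip_eq0 v0) !ip0r expr2 !mulr0.
have v_gt0 : 0 < ip v v by rewrite lt_def v0 ip_ge0.
have := ip_ge0 (ip v v *: u - ip u v *: v).
rewrite !(ipBl, ipBr, ipZl, ipZr) (ipC v u) => h.
rewrite -subr_ge0 -(pmulr_rge0 _ v_gt0).
by apply: le_trans h _; rewrite le_eqVlt; apply/orP; left; apply/eqP; ring.
Qed.

Lemma norm2_sqr n (u : 'cV[R]_n) : norm2 u ^+ 2 = ip u u.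
Proof.
rewrite sqr_sqrtr; last by apply: sumr_ge0 => i _; exact: sqr_ge0.
by apply: eq_bigr => i _; rewrite expr2.
Qed.

Lemma norm2_ge0 n (u : 'cV[R]_n) : 0 <= norm2 u.
Proof. exact: sqrtr_ge0. Qed.

Lemma norm2_le n (u : 'cV[R]_n) a : 0 <= a -> ip u u <= a ^+ 2 -> norm2 u <= a.
Proof.
by move=> a0; rewrite -norm2_sqr ler_pXn2r ?nnegrE ?norm2_ge0.
Qed.

Lemma norm2_le_sqrt n m (u : 'cV[R]_n) (v : 'cV[R]_m) c :
  0 <= c -> ip u u <= c * ip v v -> norm2 u <= Num.sqrt c * norm2 v.
Proof.
move=> c0 uv; apply: norm2_le; first by rewrite mulr_ge0 ?sqrtr_ge0 ?norm2_ge0.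
by rewrite exprMn sqr_sqrtr// norm2_sqr.
Qed.

Lemma ip_le_norm2 n (u v : 'cV[R]_n) : ip u v <= norm2 u * norm2 v.
Proof.
apply: le_trans (ler_norm _) _.
rewrite -(@ler_pXn2r _ 2)// ?nnegrE ?mulr_ge0 ?norm2_ge0//.
by rewrite exprMn !norm2_sqr real_normK ?num_real// cauchy_schwarz.
Qed.

Lemma ler_norm2D n (u v : 'cV[R]_n) : norm2 (u + v) <= norm2 u + norm2 v.
Proof.
apply: norm2_le; first by rewrite addr_ge0 ?norm2_ge0.
rewrite !(ipDl, ipDr) sqrrD !norm2_sqr (ipC v u).
by have := ip_le_norm2 u v; lra.
Qed.

Lemma norm2N n (u : 'cV[R]_n) : norm2 (- u) = norm2 u.
Proof. by congr Num.sqrt; apply: eq_bigr => i _; rewrite mxE sqrrN. Qed.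

Lemma norm1_ge0 n (u : 'cV[R]_n) : 0 <= norm1 u.
Proof. exact: sumr_ge0. Qed.

Lemma norm2_le_norm1 n (u : 'cV[R]_n) : norm2 u <= norm1 u.
Proof.
apply: norm2_le; first exact: norm1_ge0.
rewrite expr2 {1}/norm1 mulr_suml; apply: ler_sum => i _.
rewrite -expr2 -real_normK ?num_real// expr2 ler_wpM2l//.
by rewrite /norm1 (bigD1 i)//= lerDl sumr_ge0.
Qed.

End InnerProduct.

(** * Quadratic forms of symmetric matrices and singular values *)

Section Rayleigh.
Variable R : realType.

(** Unitary diagonalisation over the complex numbers turns the form into the sum of d_i |(P v)_i|^2,
    where d is the spectrum of [G]. *)
Lemma sym_form_ge0 n (G : 'M[R]_n) : G^T = G ->
  (forall a, eigenvalue G a -> 0 <= a) -> forall v, 0 <= ip v (G *m v).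
Proof.
move=> Gsym Gpos v; pose c := real_complex R.
pose Gc := map_mx c G; pose vc := map_mx c v.
have Ghs : Gc \is hermsymmx.
  apply: realsym_hermsym.
    apply/is_hermitianmxP; rewrite expr0 scale1r map_mx_id//.
    by rewrite /Gc map_trmx Gsym.
  by apply/mxOverP => i j; rewrite mxE; apply/complex_realP; exists (G i j).
have Greal := hermitian_spectral_diag_real Ghs.
have := hermitian_normalmx Ghs => /orthomx_spectralP.
set P := spectralmx Gc; set d := spectral_diag Gc => Geq.
have PU : P \in unitmx := spectral_unit Gc.
(* Each d_i is real and has the i-th row of the invertible [P] as a nonzero left eigenvector; a real
   eigenvalue of the complexification is one of [G]. *)
have dpos i : 0 <= d 0 i.
  have /complex_realP[k dk] : d 0 i \is Num.real by apply/mxOverP.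
  rewrite dk ler0c; apply: Gpos; rewrite -(eigenvalue_map (real_complex R)).
  apply/eigenvalueP; exists (row i P).
    rewrite -/c -/Gc -row_mul Geq -mulmxA mulKVmx// row_mul row_diag_mx dk.
    by rewrite -scalemxAl -rowE.
  apply/eqP => Pi0; have := mulmxV PU => /(congr1 (row i)).
  rewrite row_mul Pi0 mul0mx => /rowP/(_ i)/eqP.
  by rewrite !mxE eqxx eq_sym oner_eq0.
rewrite -ler0c.
suff -> : (ip v (G *m v))%:C%C = \sum_i d 0 i * `|(P *m vc) i 0| ^+ 2.
  by apply: sumr_ge0 => i _; rewrite mulr_ge0// exprn_ge0.
have -> : (ip v (G *m v))%:C%C = (vc^T *m Gc *m vc) 0 0.
  by rewrite ipE mulmxA /vc /Gc map_trmx -!map_mxM [RHS]mxE.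
have vcC : vc^T = (map_mx Num.conj vc)^T.
  apply/matrixP => i j; rewrite !mxE; symmetry; apply/CrealP.
  by apply/complex_realP; eexists.
rewrite Geq invmx_unitary ?spectral_unitarymx// -/P -!mulmxA mulmxA vcC.
have -> : (map_mx Num.conj vc)^T *m map_mx Num.conj (P^T) = (map_mx Num.conj (P *m vc))^T.
  by rewrite map_mxM trmx_mul !map_trmx.
rewrite mxE; apply: eq_bigr => i _; rewrite mul_diag_mx [_ i 0]mxE.
by rewrite !mxE normCKC mulrCA.
Qed.

(** Positivity applied to the shifts [G - lo%:M] and [hi%:M - G], whose eigenvalues are a - lo and
    hi - a for a in the spectrum of [G]. *)
Lemma sym_form_bounds n (G : 'M[R]_n) (lo hi : R) : G^T = G ->
  (forall a, eigenvalue G a -> lo <= a <= hi) ->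
  forall v, lo * ip v v <= ip v (G *m v) <= hi * ip v v.
Proof.
move=> Gsym Geig v; apply/andP; split; rewrite -subr_ge0.
- have -> : ip v (G *m v) - lo * ip v v = ip v ((G - lo%:M) *m v).
    by rewrite mulmxBl mul_scalar_mx ipBr ipZr.
  apply: sym_form_ge0; first by rewrite linearB /= tr_scalar_mx Gsym.
  move=> a /eigenvalueP[u uG u0]; rewrite -(lerD2r lo) add0r.
  suff /Geig/andP[] : eigenvalue G (a + lo) by [].
  apply/eigenvalueP; exists u => //.
  by rewrite scalerDl -uG mulmxBr mul_mx_scalar subrK.
- have -> : hi * ip v v - ip v (G *m v) = ip v ((hi%:M - G) *m v).
    by rewrite mulmxBl mul_scalar_mx ipBr ipZr.
  apply: sym_form_ge0; first by rewrite linearB /= tr_scalar_mx Gsym.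
  move=> a /eigenvalueP[u uG u0].
  suff /Geig/andP[_] : eigenvalue G (hi - a) by rewrite gerBl.
  apply/eigenvalueP; exists u => //.
  by rewrite scalerBl -uG mulmxBr mul_mx_scalar opprB addrC subrK.
Qed.

(* A positive lower bound on [sigma] rules out the junk value [::] of
   [singular_values], so the list really factors the characteristic
   polynomial. *)
Lemma sigma_bounds m n (X : 'M[R]_(m, n)) (lo hi : R) : 0 < lo -> (0 < n)%N ->
  lo <= sigma n X -> sigma 1 X <= hi ->
  forall v, lo ^+ 2 * ip v v <= ip (X *m v) (X *m v) <= hi ^+ 2 * ip v v.
Proof.
move=> lo0 n0; rewrite /sigma; set l := singular_values X => lon hi1 v.
have lN0 : l != [::].
  by apply: contraTneq lon => ->; rewrite nth_nil -ltNge.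
have [sl pl cl] : is_singular_values X l.
  by move: lN0; rewrite /l /singular_values; case: xgetP => [//|_ /eqP].
move: cl; rewrite -(big_map (fun a : R => a ^+ 2) xpredT (fun b => 'X - b%:P)) => cl.
(* The characteristic polynomial has degree n, so there are n singular values and [sigma n X] is the
   last, hence the smallest. *)
have szl : size l = n.
  apply: succn_inj; rewrite -[RHS](size_char_poly (X^T *m X)) cl.
  by rewrite size_prod_XsubC size_map.
rewrite ip_mull mulmxA; apply: sym_form_bounds => [|a].
  by rewrite trmx_mul trmxK.
rewrite eigenvalue_root_char cl root_prod_XsubC => /mapP[b bl ->].
have [k kn bi] : exists2 k, (k < n)%N & l`_k = b.
  by exists (index b l); rewrite ?nth_index// -szl index_mem.
have gtr : transitive (>=%R : rel R) by move=> x y z /= xy yz; exact: le_trans yz xy.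
have b0 : 0 <= b by apply: (allP pl).
have lob : lo <= b.
  apply: le_trans lon _; rewrite -bi; have kn1 : (k <= n.-1)%N by lia.
  by apply: (sorted_leq_nth gtr (@lexx _ R)) => //; rewrite ?inE ?szl //; lia.
have hib : b <= hi.
  apply: le_trans hi1; rewrite -bi.
  by apply: (sorted_leq_nth gtr (@lexx _ R)) => //; rewrite ?inE ?szl //; lia.
by rewrite !ler_pXn2r ?nnegrE ?lob ?hib//; lra.
Qed.

End Rayleigh.

(** * Column submatrices and tails *)

Section Columns.
Variable R : realType.
Implicit Types m n : nat.

Lemma zero_extend_in n (T : {set 'I_n}) (w : 'cV[R]_#|T|) j :
  zero_extend w (enum_val j) 0 = w j 0.
Proof.
rewrite mxE (bigD1 j)//= big1 ?addr0// => k /andP[/eqP/enum_val_inj ->].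
by rewrite eqxx.
Qed.

Lemma zero_extend_out n (T : {set 'I_n}) (w : 'cV[R]_#|T|) i :
  i \notin T -> zero_extend w i 0 = 0.
Proof.
move=> iT; rewrite mxE big_pred0// => j; apply/negbTE.
by apply: contraNneq iT => <-; exact: enum_valP.
Qed.

(** The function [F] stands for the terms of a matrix product as well as for those of a squared
    norm. *)
Lemma sum_zero_extend n (T : {set 'I_n}) (w : 'cV[R]_#|T|) (F : 'I_n -> R -> R) :
  (forall i, F i 0 = 0) ->
  \sum_i F i (zero_extend w i 0) = \sum_j F (enum_val j) (w j 0).
Proof.
move=> F0; rewrite (bigID (mem T))/= [X in _ + X]big1 ?addr0; last first.
  by move=> i iT; rewrite zero_extend_out.
by rewrite big_enum_val; apply: eq_bigr => j _; rewrite zero_extend_in.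
Qed.

Lemma mulmx_zero_extend m n (T : {set 'I_n}) (X : 'M[R]_(m, n)) (w : 'cV[R]_#|T|) :
  X *m zero_extend w = cols T X *m w.
Proof.
apply/colP => k; rewrite !mxE.
rewrite (sum_zero_extend w (F := fun i a => X k i * a))/=; last first.
  by move=> i; rewrite mulr0.
by apply: eq_bigr => j _; rewrite !mxE.
Qed.

Lemma ip_zero_extend n (T : {set 'I_n}) (w : 'cV[R]_#|T|) :
  ip (zero_extend w) (zero_extend w) = ip w w.
Proof. by apply: (sum_zero_extend w (F := fun _ a => a * a)) => _; rewrite mulr0. Qed.

Lemma norm2_zero_extend n (T : {set 'I_n}) (w : 'cV[R]_#|T|) :
  norm2 (zero_extend w) = norm2 w.
Proof.
apply/eqP; rewrite -(@eqrXn2 _ 2)// ?norm2_ge0//.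
by rewrite !norm2_sqr ip_zero_extend.
Qed.

Lemma zero_extendB n (T : {set 'I_n}) (v w : 'cV[R]_#|T|) :
  zero_extend (v - w) = zero_extend v - zero_extend w.
Proof.
apply/colP => i; rewrite !mxE -sumrB.
by apply: eq_bigr => j _; rewrite !mxE.
Qed.

Lemma sparse_zero_extend n (T : {set 'I_n}) (w : 'cV[R]_#|T|) :
  sparse #|T| (zero_extend w).
Proof.
apply: subset_leq_card; apply/fintype.subsetP => i; rewrite inE.
by apply: contraNT => /zero_extend_out ->.
Qed.

Lemma restrict_toE n (T : {set 'I_n}) (x : 'cV[R]_n) :
  restrict_to T x = zero_extend (\col_(j < #|T|) x (enum_val j) 0).
Proof.
apply/colP => i; rewrite mxE; case: ifPn => iT; last by rewrite zero_extend_out.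
by rewrite -{2}(enum_rankK_in iT iT) zero_extend_in mxE enum_rankK_in.
Qed.

Lemma restrict_toT n (x : 'cV[R]_n) : restrict_to [set: 'I_n] x = x.
Proof. by apply/colP => i; rewrite mxE inE. Qed.

Lemma restrict_toD n (B T : {set 'I_n}) (x : 'cV[R]_n) : B \subset T ->
  restrict_to T x = restrict_to B x + restrict_to (T :\: B) x.
Proof.
move=> BT; apply/colP => i; rewrite !mxE inE.
by case: (boolP (i \in B)) => [/(fintype.subsetP BT) ->|_]; rewrite ?addr0 ?add0r.
Qed.

Lemma restrict_toC n (T : {set 'I_n}) (x : 'cV[R]_n) :
  x = restrict_to T x + restrict_to (~: T) x.
Proof. by rewrite -{1}[x]restrict_toT (restrict_toD _ (finset.subsetT T)) finset.setTD. Qed.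

Lemma ip_restrict_to n (T : {set 'I_n}) (x : 'cV[R]_n) :
  ip (restrict_to T x) (restrict_to T x) = \sum_(i in T) x i 0 ^+ 2.
Proof.
rewrite [RHS]big_mkcond; apply: eq_bigr => i _; rewrite !mxE.
by case: ifP => _; rewrite ?mulr0// expr2.
Qed.

Lemma norm2_restrict_to n (T : {set 'I_n}) (x : 'cV[R]_n) :
  norm2 (restrict_to T x) <= norm2 x.
Proof.
apply: norm2_le; rewrite ?norm2_ge0// norm2_sqr ip_restrict_to.
rewrite big_mkcond; apply: ler_sum => i _.
by case: ifP => _; rewrite -expr2 ?sqr_ge0.
Qed.

(** Greedy choice: each step adds a maximiser of [g] over the rest of [T], which the elements chosen
    before already dominate. *)
Lemma top_subset (I : finType) (g : I -> R) (T : {set I}) k : (k <= #|T|)%N ->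
  exists B : {set I}, [/\ B \subset T, #|B| = k
    & forall i j, i \in B -> j \in T :\: B -> g j <= g i].
Proof.
elim: k => [_|k IH kT].
  by exists finset.set0; split; rewrite ?finset.sub0set ?cards0// => i j; rewrite inE.
have [B [BT Bk Bg]] := IH (ltnW kT).
have /card_gt0P[i0 i0P] : (0 < #|T :\: B|)%N.
  by rewrite cardsDS// Bk subn_gt0.
case: (arg_maxP (P := fun i => i \in T :\: B) g i0P) => i /= + imax.
rewrite finset.in_setD => /andP[iB iT]; exists (i |: B); split.
- by rewrite finset.subUset finset.sub1set BT iT.
- by rewrite cardsU1 Bk iB.
- move=> a b; rewrite finset.in_setU1 finset.in_setD finset.in_setU1 negb_or.
  move=> /orP[/eqP ->|aB] /andP[/andP[_ bB] bT].
    by apply: imax; rewrite /= finset.in_setD bB.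
  by apply: Bg => //; rewrite finset.in_setD bB.
Qed.

(** Passage from singular values to the restricted isometry form. The empty set, excluded from
    [uniform_sv_bounds], carries only the zero vector. *)
Lemma uniform_sv_boundsP m n (eps : R) s (X : 'M[R]_(m, n)) :
  -1 <= eps -> eps < 1 -> uniform_sv_bounds eps s X ->
  forall T : {set 'I_n}, (#|T| <= s)%N -> forall w : 'cV[R]_#|T|,
  (1 - eps) * ip w w <= ip (cols T X *m w) (cols T X *m w) <= (1 + eps) * ip w w.
Proof.
move=> e1 e2 H T Ts w; have [T0|TN0] := eqVneq T finset.set0.
  suff -> : w = 0 by rewrite mulmx0 !ip0l !mulr0 lexx.
  by apply/colP => -[j]; subst T => jlt; exfalso; move: jlt; rewrite cards0.
have [h1 _ h3] := H T TN0 Ts.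
have h0 : (0 < #|T|)%N by rewrite card_gt0.
have h4 : 0 < Num.sqrt (1 - eps) by rewrite sqrtr_gt0; lra.
have := sigma_bounds h4 h0 h1 h3 w.
by rewrite !sqr_sqrtr //; lra.
Qed.

(** * Images of vectors that are not sparse *)

Section BlockDecomposition.
Variables (m n s : nat) (X : 'M[R]_(m, n)) (c : R).
Hypotheses (s_gt0 : (0 < s)%N) (c_ge0 : 0 <= c).
Hypothesis X_sparse : forall (T : {set 'I_n}) x, (#|T| <= s)%N ->
  norm2 (X *m restrict_to T x) <= c * norm2 (restrict_to T x).

Let sr : R := s%:R.
Let sr_gt0 : 0 < sr. Proof. by rewrite ltr0n. Qed.
Let q : R := Num.sqrt sr.
Let q_gt0 : 0 < q. Proof. by rewrite sqrtr_gt0. Qed.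
Let qq : q * q = sr. Proof. by rewrite -expr2 sqr_sqrtr// ltW. Qed.

(* The average of the [s] largest entries bounds all the others, and is the
   bound [M] handed to the next block in [norm2_mulmx_bounded]. *)
Let top_average (x : 'cV[R]_n) (B T : {set 'I_n}) : #|B| = s ->
  (forall i j, i \in B -> j \in T :\: B -> `|x j 0| <= `|x i 0|) ->
  forall j, j \in T :\: B -> `|x j 0| <= (\sum_(i in B) `|x i 0|) / sr.
Proof.
move=> Bs Bx j jT; rewrite ler_pdivlMr// mulr_natr -Bs -sumr_const.
by apply: ler_sum => i iB; exact: Bx.
Qed.

(** Induction peels off the s largest entries. A block of s entries bounded by M has norm at most
    sqrt(s) M, and the rest is bounded by the block average M'. As sqrt(s) M' is the l1 norm of the
    block over sqrt(s), the contributions add up to the l1 term. *)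
Lemma norm2_mulmx_bounded (x : 'cV[R]_n) (T : {set 'I_n}) M : 0 <= M ->
  (forall i, i \in T -> `|x i 0| <= M) ->
  norm2 (X *m restrict_to T x) <= c * (q * M + (\sum_(i in T) `|x i 0|) / q).
Proof.
have [k] := ubnP #|T|; elim: k T M => // k IH T M Tk M0 TM.
have [Ts|sT] := leqP #|T| s.
  apply: le_trans (X_sparse x Ts) _; apply: ler_wpM2l => //.
  apply: (@le_trans _ _ (q * M)).
    apply: norm2_le; first by rewrite mulr_ge0// ltW.
    rewrite exprMn expr2 qq ip_restrict_to.
    apply: (@le_trans _ _ (\sum_(i in T) M ^+ 2)).
      apply: ler_sum => i iT; rewrite -real_normK ?num_real//.
      by rewrite ler_pXn2r ?nnegrE// TM.
    by rewrite sumr_const -mulr_natl ler_wpM2r ?sqr_ge0// ler_nat.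
  by rewrite lerDl divr_ge0 ?sumr_ge0// ltW.
have [B [BT Bs Bx]] := top_subset (fun i => `|x i 0|) (ltnW sT).
rewrite (restrict_toD _ BT) mulmxDr; apply: le_trans (ler_norm2D _ _) _.
have Bs' : (#|B| <= s)%N by rewrite Bs.
pose M' := (\sum_(i in B) `|x i 0|) / sr.
have M'0 : 0 <= M' by rewrite divr_ge0 ?sumr_ge0// ltW.
have h1 : norm2 (X *m restrict_to B x) <= c * (q * M).
  apply: le_trans (X_sparse x Bs') _; apply: ler_wpM2l => //.
  apply: norm2_le; first by rewrite mulr_ge0// ltW.
  rewrite exprMn expr2 qq ip_restrict_to /sr -Bs mulr_natl -sumr_const.
  apply: ler_sum => i iB; rewrite -real_normK ?num_real//.
  by rewrite ler_pXn2r ?nnegrE// TM// (fintype.subsetP BT).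
have h2 : norm2 (X *m restrict_to (T :\: B) x) <=
    c * (q * M' + (\sum_(i in T :\: B) `|x i 0|) / q).
  apply: IH => //; last exact: top_average.
  by rewrite cardsDS// Bs; lia.
apply: le_trans (lerD h1 h2) _; rewrite -mulrDr ler_wpM2l//.
rewrite [in leRHS](big_setID B)/= (finset.setIidPr BT) mulrDl /M' -qq.
rewrite le_eqVlt; apply/orP; left; apply/eqP; field.
by rewrite gt_eqF.
Qed.

(** The first block has no predecessor bounding its entries, so it is measured by its own Euclidean
    norm; its average starts the induction on the rest. *)
Lemma norm2_mulmx_le x : norm2 (X *m x) <= c * (norm2 x + norm1 x / q).
Proof.
have nq : 0 <= norm1 x / q by rewrite divr_ge0 ?norm1_ge0// ltW.
have [ns|sn] := leqP #|[set: 'I_n]| s.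
  have := X_sparse x ns; rewrite restrict_toT => h; apply: le_trans h _.
  by rewrite ler_wpM2l// lerDl.
have [B [BT Bs Bx]] := top_subset (fun i => `|x i 0|) (ltnW sn).
rewrite -{1}[x]restrict_toT (restrict_toD _ BT) mulmxDr.
apply: le_trans (ler_norm2D _ _) _.
have Bs' : (#|B| <= s)%N by rewrite Bs.
have h1 : norm2 (X *m restrict_to B x) <= c * norm2 x.
  by apply: le_trans (X_sparse x Bs') _; rewrite ler_wpM2l ?norm2_restrict_to.
pose M' := (\sum_(i in B) `|x i 0|) / sr.
have M'0 : 0 <= M' by rewrite divr_ge0 ?sumr_ge0// ltW.
have h2 := norm2_mulmx_bounded M'0 (top_average Bs Bx).
apply: le_trans (lerD h1 h2) _; rewrite -mulrDr ler_wpM2l// lerD2l.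
have -> : norm1 x = \sum_(i in [set: 'I_n]) `|x i 0|.
  by apply: eq_bigl => i; rewrite inE.
rewrite [in leRHS](big_setID B)/= (finset.setIidPr BT) mulrDl /M' -qq.
rewrite le_eqVlt; apply/orP; left; apply/eqP; field.
by rewrite gt_eqF.
Qed.

End BlockDecomposition.

End Columns.

(** * Conjugate gradient *)

Lemma bind_eq (T U : Type) (x : Timed T) (k : T -> Timed U) a c u c' :
  x = (a, c) -> k a = (u, c') -> bind x k = (u, (c + c')%N).
Proof. by rewrite /bind => -> /= ->. Qed.

(** * Values and costs of the timed operations *)

Section CGSteps.
Variables (R : realType) (m n : nat) (A : 'M[R]_(m, n)).

(** Each of the m entries costs n products, n additions and a store. *)
Lemma apply_mxE v : apply_mx A v = (A *m v, (m * (2 * n).+1)%N).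
Proof.
congr pair; first by apply/colP => i; rewrite !mxE.
rewrite /= sum_nat_const card_ord; congr (_ * _.+1)%N.
by rewrite /= sum_nat_const card_ord mulnC.
Qed.

Lemma apply_trmxE v : apply_trmx A v = (A^T *m v, (n * (2 * m).+1)%N).
Proof.
congr pair.
  by apply/colP => i; rewrite !mxE; apply: eq_bigr => j _; rewrite mxE.
rewrite /= sum_nat_const card_ord; congr (_ * _.+1)%N.
by rewrite /= sum_nat_const card_ord mulnC.
Qed.

Lemma dotE k (u v : 'cV[R]_k) : dot u v = (ip u v, (2 * k)%N).
Proof. by congr pair; rewrite /= sum_nat_const card_ord mulnC. Qed.

Lemma axpyE k (u v : 'cV[R]_k) a : axpy u a v = (u + a *: v, (3 * k)%N).
Proof.
congr pair; first by apply/colP => i; rewrite !mxE.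
by rewrite /= sum_nat_const card_ord mulnC.
Qed.

Lemma axmyE k (u v : 'cV[R]_k) a : axmy u a v = (u - a *: v, (3 * k)%N).
Proof.
congr pair; first by apply/colP => i; rewrite !mxE.
by rewrite /= sum_nat_const card_ord mulnC.
Qed.

Lemma cg_initE (b : 'cV[R]_m) :
  cg_init A b = (CGState 0 b (A^T *m b) (ip (A^T *m b) (A^T *m b)),
                 (2 * m * n + m + 4 * n)%N).
Proof.
rewrite /cg_init /bind !apply_trmxE !dotE /=.
have -> : \col_i b i 0 = b by apply/colP => i; rewrite mxE.
have -> : \col_(_ < n) 0 = 0 :> 'cV[R]_n by apply/colP => i; rewrite !mxE.
congr pair; rewrite !sum_nat_const !card_ord; lia.
Qed.

Lemma cg_stepE st :
  let q := A *m dir st in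
  let alpha := gamma st / ip q q in
  let r := res st - alpha *: q in
  let g := A^T *m r in
  cg_step A st =
    (CGState (sol st + alpha *: dir st) r
       (g + (ip g g / gamma st) *: dir st) (ip g g),
     (4 * (m * n) + 6 * m + 9 * n + 2)%N).
Proof.
(* [etrans] leaves the result and its cost open; the chain of [bind_eq] fills them in one operation
   at a time, and the total is compared at the end. *)
move=> q alpha r g; rewrite /cg_step; eapply etrans.
  eapply bind_eq; first exact: apply_mxE.
  eapply bind_eq; first exact: dotE.
  eapply bind_eq; first exact: erefl.
  eapply bind_eq; first exact: axpyE.
  eapply bind_eq; first exact: axmyE.
  eapply bind_eq; first exact: apply_trmxE.
  eapply bind_eq; first exact: dotE.
  eapply bind_eq; first exact: erefl.
  by eapply bind_eq; [exact: axpyE | exact: erefl].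
by congr pair; lia.
Qed.

End CGSteps.

(** * Descent of the energy and termination of the loop *)

Section CGConvergence.
Variables (R : realType) (m n : nat) (A : 'M[R]_(m, n)) (b : 'cV[R]_m).
Variables (lo hi : R).
Hypotheses (lo_gt0 : 0 < lo) (lohi : lo <= hi).
Hypothesis A_bounds : forall w,
  lo * ip w w <= ip (A *m w) (A *m w) <= hi * ip w w.

Let hi_gt0 : 0 < hi. Proof. exact: lt_le_trans lohi. Qed.

(** The positive lower bound on ||A w||^2 makes the Gram matrix injective, hence invertible. *)
Lemma normal_equation_solvable : exists z, A^T *m (b - A *m z) = 0.
Proof.
have GU : A^T *m A \in unitmx.
  rewrite -row_free_unit; apply/inj_row_free => v vG.
  have : (v *m (A^T *m A))^T = 0 by rewrite vG trmx0.
  rewrite trmx_mul trmx_mul trmxK => Gv; have := A_bounds v^T; rewrite ip_mull mulmxA Gv ip0r.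
  rewrite pmulr_rle0// => /andP[v0 _].
  apply: trmx_inj; rewrite trmx0; apply: ip_eq0.
  by apply/eqP; rewrite eq_le v0 ip_ge0.
exists (invmx (A^T *m A) *m (A^T *m b)).
by rewrite mulmxBr mulmxA mulmxA mulmxV// mul1mx subrr.
Qed.

Variable z : 'cV[R]_n.
Hypothesis z_normal : A^T *m (b - A *m z) = 0.

Lemma normal_equation_argmin : lsq_argmin A b z.
Proof.
move=> w; apply: norm2_le; first exact: norm2_ge0.
have -> : A *m w - b = A *m (w - z) + (A *m z - b).
  by rewrite mulmxBr addrA subrK.
have o : ip (A *m (w - z)) (A *m z - b) = 0.
  by rewrite ip_mull -(opprB b) mulmxN z_normal oppr0 ip0r.
by rewrite norm2_sqr (ip_pythagoras o) lerDr ip_ge0.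
Qed.

(** [grad w] is minus half the gradient of ||A w - b||^2, and [energy w] is the excess of this
    functional over its minimum at [z]. *)
Let grad w := A^T *m (b - A *m w).
Let energy w := ip (A *m (z - w)) (A *m (z - w)).

Lemma gradE w : grad w = A^T *m (A *m (z - w)).
Proof.
rewrite /grad -[b](subrK (A *m z)) -addrA mulmxDr z_normal add0r.
by rewrite -mulmxBr.
Qed.

(** Cauchy-Schwarz on ||g||^2 = (A g, A (z - w)). This is what makes the stopping test succeed once
    the energy is small. *)
Lemma grad_le_energy w : ip (grad w) (grad w) <= hi * energy w.
Proof.
set g := grad w; have [->|g0] := eqVneq (ip g g) 0.
  by rewrite mulr_ge0 ?ip_ge0// ltW.
have g_gt0 : 0 < ip g g by rewrite lt_def g0 ip_ge0.
rewrite -(ler_pM2l g_gt0).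
have -> : ip g g * ip g g = ip (A *m g) (A *m (z - w)) ^+ 2.
  by rewrite ip_mull -gradE expr2.
apply: le_trans (cauchy_schwarz _ _) _.
have /andP[_ h] := A_bounds g.
by rewrite mulrA ler_wpM2r ?ip_ge0// mulrC.
Qed.

(** Cauchy-Schwarz on energy = (z - w, g). It serves both the descent rate and the accuracy
    guaranteed by the stopping test. *)
Lemma energy_le_grad w : lo * energy w <= ip (grad w) (grad w).
Proof.
have [E0|E0] := eqVneq (energy w) 0; first by rewrite E0 mulr0 ip_ge0.
have E_gt0 : 0 < energy w by rewrite lt_def E0 ip_ge0.
rewrite -(ler_pM2l E_gt0).
have EE : energy w * energy w = ip (z - w) (grad w) ^+ 2.
  by rewrite /energy ip_mull -gradE expr2.
rewrite mulrCA EE.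
have /andP[h _] := A_bounds (z - w).
apply: le_trans (ler_wpM2l (ltW lo_gt0) (cauchy_schwarz _ _)) _.
by rewrite mulrA ler_wpM2r ?ip_ge0.
Qed.

(* Conjugacy with the previous direction [p'] alone suffices: it makes
   the step at least as good as steepest descent. *)
Definition cg_invariant (st : cg_state R m n) : Prop :=
  [/\ res st = b - A *m sol st,
      gamma st = ip (grad (sol st)) (grad (sol st))
    & exists p' c, [/\ dir st = grad (sol st) + c *: p',
        ip (grad (sol st)) p' = 0 & ip (A *m dir st) (A *m p') = 0]].

Lemma cg_invariant_init : cg_invariant (cg_init A b).1.
Proof.
rewrite cg_initE /=; split; rewrite /grad /= ?mulmx0 ?subr0//.
(* The first direction is the gradient itself, so the previous direction is taken to be 0. *)
by exists 0, 0; rewrite mulmx0 !ip0r scaler0 addr0.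
Qed.

Lemma cg_dir_grad st : cg_invariant st ->
  ip (grad (sol st)) (dir st) = gamma st.
Proof.
by move=> [_ -> [p' [c [-> gp _]]]]; rewrite ipDr ipZr gp mulr0 addr0.
Qed.

Lemma cg_dir_le_grad st : cg_invariant st ->
  ip (A *m dir st) (A *m dir st) <=
  ip (A *m grad (sol st)) (A *m grad (sol st)).
Proof.
move=> [_ _ [p' [c [pE _ pA]]]].
have -> : grad (sol st) = dir st - c *: p' by rewrite pE addrK.
rewrite mulmxBr -scalemxAr !(ipBl, ipBr, ipZl, ipZr) pA.
rewrite (ipC (A *m p') (A *m dir st)) pA !mulr0 subr0 sub0r opprK.
by rewrite lerDl mulrA -expr2 mulr_ge0 ?sqr_ge0 ?ip_ge0.
Qed.

(** Keeps the denominator of the step length nonzero: (g, p) = gamma > 0 forces p to be nonzero, and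
    A is injective. *)
Lemma cg_dir_gt0 st : cg_invariant st -> 0 < gamma st ->
  0 < ip (A *m dir st) (A *m dir st).
Proof.
move=> inv g0; rewrite lt_def ip_ge0 andbT; apply: contraTneq g0 => q0.
have /andP[h _] := A_bounds (dir st); rewrite q0 pmulr_rle0// in h.
have p0 : dir st = 0 by apply: ip_eq0; apply/eqP; rewrite eq_le h ip_ge0.
by rewrite -(cg_dir_grad inv) p0 ip0r ltxx.
Qed.

(** The new gradient g' is orthogonal to p by the line search and to p' by conjugacy, hence to g = p
    - c p'. The coefficient ||g'||^2 / gamma then makes the new direction conjugate to p. *)
Lemma cg_invariant_step st : cg_invariant st -> 0 < gamma st ->
  cg_invariant (cg_step A st).1.
Proof.
move=> inv g0; have q0 := cg_dir_gt0 inv g0; have gp := cg_dir_grad inv.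
have [rE gE [p' [c [pE gp' pA]]]] := inv.
rewrite cg_stepE /=; set p := dir st in q0 gp pE pA *.
set q := ip (A *m p) (A *m p) in q0 *.
set alpha := gamma st / q; set g := grad (sol st) in gp gE pE gp' *.
have rE' : res st - alpha *: (A *m p) = b - A *m (sol st + alpha *: p).
  by rewrite rE mulmxDr -scalemxAr opprD addrA.
rewrite rE' -/(grad _); set g' := grad (sol st + _).
have g'E : g' = g - alpha *: (A^T *m (A *m p)).
  by rewrite /g' /grad -rE' rE mulmxBr -!scalemxAr.
have g'p : ip g' p = 0.
  rewrite g'E ipBl gp ipZl ip_trmull -/q /alpha divfK ?subrr//.
  by rewrite gt_eqF.
have g'p' : ip g' p' = 0.
  by rewrite g'E ipBl gp' ipZl ip_trmull pA mulr0 subr0.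
have g'g : ip g' g = 0.
  have -> : g = p - c *: p' by rewrite pE addrK.
  by rewrite ipBr ipZr g'p g'p' mulr0 subr0.
split => //=; exists p, (ip g' g' / gamma st); split => //.
have a0 : alpha != 0 by rewrite mulf_neq0 ?invr_eq0 ?gt_eqF.
(* Since alpha A^T A p = g - g' and g' is orthogonal to g, only -||g'||^2 survives. *)
have g'A : ip (A *m g') (A *m p) = - ip g' g' / alpha.
  rewrite ip_mull; apply: (mulfI a0); rewrite -ipZr mulrCA divff// mulr1.
  have -> : alpha *: (A^T *m (A *m p)) = g - g' by rewrite g'E opprB addrCA subrr addr0.
  by rewrite ipBr g'g sub0r.
rewrite mulmxDr -scalemxAr ipDl ipZl g'A -/q /alpha.
by field; rewrite !gt_eqF.
Qed.

(** The line search lowers the energy by gamma^2 / ||A p||^2. As ||A p||^2 <= ||A g||^2 <= hi gamma,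
    this is at least gamma / hi, hence at least (lo / hi) times the energy. *)
Lemma cg_energy_step st : cg_invariant st -> 0 < gamma st ->
  energy (sol (cg_step A st).1) <= (1 - lo / hi) * energy (sol st).
Proof.
move=> inv g0; have q0 := cg_dir_gt0 inv g0; have gp := cg_dir_grad inv.
have qg := cg_dir_le_grad inv; have [_ gE _] := inv.
have /andP[_ Ag] := A_bounds (grad (sol st)).
have lE := energy_le_grad (sol st).
rewrite cg_stepE /=; set p := dir st in q0 gp qg *.
set q := ip (A *m p) (A *m p) in q0 qg *.
rewrite -gE in lE Ag.
have eAp : ip (A *m (z - sol st)) (A *m p) = gamma st.
  by rewrite -gp gradE ip_trmull.
have -> : energy (sol st + gamma st / q *: p) = energy (sol st) - gamma st ^+ 2 / q.
  rewrite /energy opprD addrA mulmxBr -scalemxAr !(ipBl, ipBr, ipZl, ipZr).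
  rewrite (ipC (A *m p) (A *m (z - _))) eAp -/q.
  by field; rewrite gt_eqF.
have h : gamma st / hi <= gamma st ^+ 2 / q.
  rewrite ler_pdivrMr// mulrAC ler_pdivlMr// expr2 -mulrA ler_pM2l// mulrC.
  exact: le_trans qg Ag.
have h2 : lo / hi * energy (sol st) <= gamma st / hi.
  by rewrite mulrAC ler_pM2r ?invr_gt0.
lra.
Qed.

(** Here k bounds the number of steps still needed. Every pass costs one step of the method and one
    comparison; the final 1 pays for the comparison that ends the loop. *)
Lemma cg_loop_terminates tau k st : 0 <= tau -> cg_invariant st ->
  hi * ((1 - lo / hi) ^+ k * energy (sol st)) <= tau ->
  exists (st' : cg_state R m n) (c : nat),
    [/\ while_run (fun st => op_lt tau (gamma st)) (cg_step A) st (st', c),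
        cg_invariant st', gamma st' <= tau
      & (c <= k * (4 * (m * n) + 6 * m + 9 * n + 3) + 1)%N].
Proof.
move=> tau0; elim: k st => [|k IH] st inv hk.
  have gt : gamma st <= tau.
    have [_ -> _] := inv; apply: le_trans (grad_le_energy _) _.
    by rewrite expr0 mul1r in hk.
  by exists st, 1%N; split => //; apply: while_stop; rewrite /= ltNge gt.
have [gt|gt] := leP (gamma st) tau.
  exists st, 1%N; split => //; last by rewrite addn1.
  by apply: while_stop; rewrite /= ltNge gt.
have g0 : 0 < gamma st by exact: le_lt_trans gt.
have inv' := cg_invariant_step inv g0.
have [|st' [c [run inv'' gt' ck]]] := IH _ inv'.
  apply: le_trans hk; rewrite ler_pM2l// exprSr -mulrA ler_wpM2l//.
    by rewrite exprn_ge0// subr_ge0 ler_pdivrMr// mul1r.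
  exact: cg_energy_step.
exists st', (1 + (cg_step A st).2 + c)%N; split => //.
  exact: (while_step (guard := fun st => op_lt tau (gamma st))).
by rewrite cg_stepE /=; lia.
Qed.

Lemma energy0 : energy 0 <= ip b b.
Proof.
rewrite /energy subr0.
have o : ip (A *m z) (b - A *m z) = 0 by rewrite ip_mull z_normal ip0r.
by rewrite -{1 2}[b](subrKC (A *m z)) (ip_pythagoras o) lerDl ip_ge0.
Qed.

Lemma cgls_run_terminates eps delta k : lo = 1 - eps -> 0 < delta ->
  (0 < m)%N -> (0 < n)%N ->
  hi * ((1 - lo / hi) ^+ k * ip b b) <= lo * delta ^+ 2 ->
  exists (w : 'cV[R]_n) (time : nat),
    [/\ cgls_run A b eps delta (w, time),
        norm2 (A *m (z - w)) <= delta
      & (time <= 22 * k.+1 * (m * n))%N].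
Proof.
move=> loE d0 m0 n0 hk; pose tau := (1 - eps) * (delta * delta).
have tauE : tau = lo * delta ^+ 2 by rewrite /tau -loE expr2.
have tau0 : 0 <= tau by rewrite tauE mulr_ge0 ?sqr_ge0// ltW.
have [|st [c [run inv gt ck]]] := @cg_loop_terminates tau k _ tau0 cg_invariant_init.
  rewrite tauE; apply: le_trans hk; rewrite ler_pM2l// ler_wpM2l//.
    by rewrite exprn_ge0// subr_ge0 ler_pdivrMr// mul1r.
  by rewrite cg_initE /= energy0.
exists (sol st), (3 + (2 * m * n + m + 4 * n) + c)%N; split.
- exists st, c; split; first by [].
  by rewrite /bind cg_initE /= addn0.
(* At exit lo times the energy is at most gamma, and gamma is at most lo delta^2. *)
- apply: norm2_le; first exact: ltW.
  rewrite -(ler_pM2l lo_gt0).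
  have [_ gE _] := inv; apply: le_trans (energy_le_grad (sol st)) _.
  by rewrite -gE -tauE.
- have mn1 : (m <= m * n)%N by rewrite leq_pmulr.
  have mn2 : (n <= m * n)%N by rewrite leq_pmull.
  (* The constant is 22 = 4 + 6 + 9 + 3, each term being at most its coefficient times m n; setup
     and the last test fit into one more such unit. *)
  have : (k * (4 * (m * n) + 6 * m + 9 * n + 3) <= k * (22 * (m * n)))%N.
    by rewrite leq_mul2l; apply/orP; right; lia.
  lia.
Qed.

End CGConvergence.

(** * Recovery from samples *)

Section Recovery.
Variable R : realType.

Lemma weighted_samplesE N m (x : 'I_m.+1 -> R) (f : {poly R}) :
  f = \sum_(n < N.+1) legendre_coef f n *: legendre R n ->
  weighted_samples x f = normalized_sampling_matrix N x *m coef_vector N f.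
Proof.
move=> fE; apply/colP => j; rewrite !mxE.
have fx : f.[x j] = \sum_(n < N.+1) legendre_coef f n * (legendre R n).[x j].
  by rewrite {1}fE horner_sum; apply: eq_bigr => n _; rewrite hornerZ.
rewrite fx mulr_sumr; apply: eq_bigr => n _; rewrite !mxE /legendreQ.
rewrite (sqrtrM _ (pi_ge0 R)) sqrtrV// (sqrtrM _ (ler0n R 2)).
have h2 : Num.sqrt 2 != 0 :> R by rewrite gt_eqF// sqrtr_gt0.
have hm : Num.sqrt m.+1%:R != 0 :> R by rewrite gt_eqF// sqrtr_gt0 ltr0n.
by field; rewrite h2 hm.
Qed.

Lemma le_expR_ln_max1 (x : R) : x <= expR (ln_max1 x).
Proof.
have [x0|x0] := leP x 0; first exact: le_trans x0 (expR_ge0 _).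
by rewrite -{1}(lnK x0) ler_expR /ln_max1 le_max lexx orbT.
Qed.

Lemma ln_max1_ge1 (x : R) : 1 <= ln_max1 x.
Proof. by rewrite /ln_max1 le_max lexx. Qed.

(** Turns a geometric rate into an iteration count linear in L, with a factor K chosen before L. The
    exponent has 2 L because the energy is a squared norm. *)
Lemma geometric_decay (r c : R) : 0 < r -> r < 1 -> 0 < c ->
  exists2 K : R, 0 < K & forall L : R, 1 <= L ->
  exists2 k : nat, k%:R <= K * L & r ^+ k * (c * expR (2 * L)) <= 1.
Proof.
move=> r0 r1 c0; pose a := - ln r.
have a0 : 0 < a by rewrite oppr_gt0 ln_lt0// r0.
(* In logarithms the goal is k a >= ln c + 2 L, and ln c <= |ln c| L because L >= 1. *)
pose K := (`|ln c| + 2) / a.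
have K0 : 0 < K by rewrite divr_gt0// ltr_wpDl.
(* The added 1 absorbs the rounding of K L up to an integer, again because L >= 1. *)
exists (K + 1) => [|L L1]; first by lra.
have KL0 : 0 <= K * L by rewrite mulr_ge0; lra.
exists (Num.truncn (K * L)).+1.
  rewrite mulrDl mul1r -natr1 lerD// truncn_le//.
have kK : K * L <= (Num.truncn (K * L)).+1%:R by rewrite ltW// truncnS_gt.
set k := _.+1 in kK *.
have -> : r ^+ k = expR (- (k%:R * a)) by rewrite /a mulrN opprK expRM_natl lnK.
rewrite -[X in _ * (X * _)](lnK c0) -!expRD -[leRHS]expR0 ler_expR.
have : (`|ln c| + 2) * L <= k%:R * a.
  by rewrite -ler_pdivrMr// mulrAC.
have : ln c <= `|ln c| * L.
  by apply: le_trans (ler_norm _) _; rewrite ler_peMr.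
rewrite /a; lra.
Qed.

(** The residual e is orthogonal to the range of A and r = e - A (u - z), so Pythagoras applies. *)
Lemma normal_equation_residual m n (A : 'M[R]_(m, n)) u r z :
  A^T *m (A *m u + r - A *m z) = 0 -> norm2 (A *m (u - z)) <= norm2 r.
Proof.
set e := _ - _ => e0; apply: norm2_le; first exact: norm2_ge0.
have -> : norm2 r ^+ 2 = ip (e - A *m (u - z)) (e - A *m (u - z)).
  rewrite norm2_sqr; suff -> : e - A *m (u - z) = r by [].
  by rewrite /e mulmxBr; apply/colP => i; rewrite !mxE; ring.
rewrite ip_pythagoras; first by rewrite ipNl ipNr opprK lerDr ip_ge0.
by rewrite ipNr ipC ip_mull e0 ip0r oppr0.
Qed.

(** The error splits into a part on S, controlled through A, and the tail. The tail enters directly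
    once and through its image with factor 2, whence 3 and 2. *)
Lemma sparse_recovery_error m n (X : 'M[R]_(m, n)) (S : {set 'I_n}) x z w delta :
  (0 < #|S|)%N -> uniform_sv_bounds (3 / 5) #|S| X ->
  (cols S X)^T *m (X *m x - cols S X *m z) = 0 ->
  norm2 (cols S X *m (z - w)) <= delta ->
  norm2 (x - zero_extend w) <= 3 * norm2 (restrict_to (~: S) x)
    + 2 * norm1 (restrict_to (~: S) x) / Num.sqrt #|S|%:R
    + Num.sqrt (5 / 2) * delta.
Proof.
move=> S0 sv nz zw; have e1 : (-1 : R) <= 3 / 5 by lra.
have e2 : (3 / 5 : R) < 1 by lra.
have rip := uniform_sv_boundsP e1 e2 sv.
set A := cols S X in nz zw *; set xc := restrict_to (~: S) x.
pose xS := \col_(j < #|S|) x (enum_val j) 0.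
have xE : x = zero_extend xS + xc by rewrite {1}(restrict_toC S x) restrict_toE.
have q0 : 0 < Num.sqrt #|S|%:R :> R by rewrite sqrtr_gt0 ltr0n.
have lower u : norm2 u <= Num.sqrt (5 / 2) * norm2 (A *m u).
  apply: norm2_le_sqrt; first by lra.
  by have /andP[h _] := rip S (leqnn _) u; rewrite -/A in h; lra.
have tail : norm2 (X *m xc) <=
    Num.sqrt (8 / 5) * (norm2 xc + norm1 xc / Num.sqrt #|S|%:R).
  apply: (norm2_mulmx_le S0); first exact: sqrtr_ge0.
  move=> T v Ts; apply: norm2_le_sqrt; first by lra.
  rewrite restrict_toE mulmx_zero_extend ip_zero_extend.
  by set v' := \col_j _; have /andP[_ h] := rip T Ts v'; lra.
have xSz : norm2 (A *m (xS - z)) <= norm2 (X *m xc).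
  apply: normal_equation_residual.
  by rewrite -mulmx_zero_extend -mulmxDr -xE.
(* With 5/2 = 1 / (1 - eps) and 8/5 = 1 + eps, this is the square root of the condition number 4. *)
have sq : Num.sqrt (5 / 2) * Num.sqrt (8 / 5) = 2 :> R.
  rewrite -sqrtrM; last by lra.
  have -> : 5 / 2 * (8 / 5) = 2 ^+ 2 :> R by lra.
  by rewrite sqrtr_sqr ger0_norm.
have main : norm2 (xS - w) <=
    2 * (norm2 xc + norm1 xc / Num.sqrt #|S|%:R) + Num.sqrt (5 / 2) * delta.
  apply: le_trans (lower _) _.
  have := ler_wpM2l (sqrtr_ge0 (5 / 2 : R)) tail; rewrite mulrA sq => h.
  apply: le_trans (lerD h (lexx _)); rewrite -mulrDr ler_wpM2l ?sqrtr_ge0//.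
  have -> : A *m (xS - w) = A *m (xS - z) + A *m (z - w).
    by rewrite -mulmxDr addrA subrK.
  by apply: le_trans (ler_norm2D _ _) _; rewrite lerD.
have -> : x - zero_extend w = zero_extend (xS - w) + xc.
  by rewrite {1}xE zero_extendB addrAC.
apply: le_trans (ler_norm2D _ _) _; rewrite norm2_zero_extend.
by move: main; rewrite mulrDr; lra.
Qed.

End Recovery.

Theorem lemma4 (R : realType) (C' : R) (hC' : 0 < C') :
  exists2 K : R, 0 < K &
  forall (N s m : nat),
    (0 < s)%N -> (s <= N)%N ->
    `|m%:R - C' * s%:R * ln (N%:R : R) ^+ 4| < 1 ->
  forall (d : measure_display) (Omega : measurableType d)
    (P : probability Omega R) (X : 'I_m.+1 -> {RV P >-> R}),
    (forall i omega, -1 <= X i omega <= 1) ->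
    mutually_independent X ->
    (forall i, chebyshev_distributed (X i)) ->
  forall (f : {poly R}),
    f = \sum_(n < N.+1) legendre_coef f n *: legendre R n ->
  forall (omega : Omega),
    let x := fun i : 'I_m.+1 => X i omega in
    let Rt := normalized_sampling_matrix N x in
    let y := weighted_samples x f in
    let ft := coef_vector N f in
    let eps : R := 3 / 5 in
    uniform_sv_bounds eps s Rt ->
  forall (delta : R) (S : {set 'I_N.+1}),
    0 < delta -> #|S| = s ->
  exists (w : 'cV[R]_#|S|) (time : nat),
    let z := zero_extend w in
    [/\ cgls_run (cols S Rt) y eps delta (w, time),
        exists2 zmin : 'cV[R]_#|S|, lsq_argmin (cols S Rt) y zmin &
          norm2 (cols S Rt *m w - y) <= norm2 (cols S Rt *m zmin - y) + delta,
        sparse s z,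
        norm2 (ft - z) <= 5 * norm2 (restrict_to (~: S) ft)
                          + 4 * norm1 (restrict_to (~: S) ft) / Num.sqrt s%:R
                          + Num.sqrt (5 / 2) * delta
      & time%:R <= K * (s%:R ^+ 2 * ln_max1 (N%:R : R) ^+ 4
                        * ln_max1 (norm1 ft / delta))].
Proof.
have r0 : 0 < 3 / 4 :> R by lra.
have r1 : 3 / 4 < 1 :> R by lra.
(* The constant is (8/5) (32/5) / (2/5): upper spectral bound, bound on ||y||^2 in terms of
   ||f||_1^2, and lower spectral bound. *)
have c0 : 0 < 128 / 5 :> R by lra.
have [K0 K0_gt0 decay] := geometric_decay r0 r1 c0.
(* The factors bound the cost per pass and matrix entry, the k + 1 passes, and the m + 1 rows. *)
exists (22 * (K0 + 1) * (C' + 2)); first by rewrite !mulr_gt0 ?addr_gt0.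
move=> N s m s0 sN hm d Omega P X _ _ _ f hf omega x Rt y ft eps sv delta S d0 Ss.
subst s; have yE : y = Rt *m ft by exact: weighted_samplesE.
have e1 : -1 <= eps by rewrite /eps; lra.
have e2 : eps < 1 by rewrite /eps; lra.
have rip := uniform_sv_boundsP e1 e2 sv.
set A := cols S Rt.
have lo0 : 0 < 1 - eps by lra.
have lohi : 1 - eps <= 1 + eps by rewrite /eps; lra.
have Ab w : (1 - eps) * ip w w <= ip (A *m w) (A *m w) <= (1 + eps) * ip w w.
  exact: rip.
have [z nz] := normal_equation_solvable y lo0 Ab.
have q1 : 1 <= Num.sqrt #|S|%:R :> R by rewrite -[leLHS]sqrtr1 ler_wsqrtr// ler1n.
have n1 := norm1_ge0 ft.
(* The block bound applied to the whole coefficient vector; both of its terms are at most the l1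
   norm, since s >= 1. *)
have yn : norm2 y <= Num.sqrt (8 / 5) * (2 * norm1 ft).
  rewrite yE; apply: le_trans (norm2_mulmx_le (c := Num.sqrt (8 / 5)) s0 _ _ _) _.
  - exact: sqrtr_ge0.
  - move=> T v Ts; apply: norm2_le_sqrt; first by lra.
    rewrite restrict_toE mulmx_zero_extend ip_zero_extend.
    by set v' := \col_j _; have /andP[_ h] := rip T Ts v'; rewrite /eps in h; lra.
  rewrite ler_wpM2l ?sqrtr_ge0// mulrDl mul1r lerD ?norm2_le_norm1//.
  by rewrite ler_pdivrMr ?(lt_le_trans ltr01)// ler_peMr.
have yy : ip y y <= 32 / 5 * norm1 ft ^+ 2.
  rewrite -norm2_sqr; apply: (@le_trans _ _ ((Num.sqrt (8 / 5) * (2 * norm1 ft)) ^+ 2)).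
    by rewrite ler_pXn2r ?nnegrE ?norm2_ge0// mulr_ge0 ?sqrtr_ge0// mulr_ge0.
  by rewrite exprMn sqr_sqrtr; lra.
set L := ln_max1 (norm1 ft / delta).
have L1 : 1 <= L by exact: ln_max1_ge1.
have [k kL hk] := decay L L1.
have rat : norm1 ft ^+ 2 <= expR (2 * L) * delta ^+ 2.
  rewrite mulrC expRM_natl -exprMn ler_pXn2r ?nnegrE ?mulr_ge0 ?expR_ge0 ?(ltW d0)//.
  by rewrite mulrC -ler_pdivrMr// le_expR_ln_max1.
have hk' : (1 + eps) * ((1 - (1 - eps) / (1 + eps)) ^+ k * ip y y)
    <= (1 - eps) * delta ^+ 2.
  have -> : 1 - (1 - eps) / (1 + eps) = 3 / 4 by rewrite /eps; field.
  set rk := (3 / 4) ^+ k in hk *.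
  have rk0 : 0 <= rk by rewrite exprn_ge0// ltW.
  have h1 : rk * ip y y <= rk * (32 / 5 * (expR (2 * L) * delta ^+ 2)).
    by apply: ler_wpM2l => //; lra.
  have h2 : rk * (128 / 5 * expR (2 * L)) * delta ^+ 2 <= 1 * delta ^+ 2.
    by rewrite ler_wpM2r// sqr_ge0.
  by rewrite /eps; lra.
have [w [time [run wz tk]]] :=
  cgls_run_terminates lo0 lohi Ab nz erefl d0 (ltn0Sn m) s0 hk'.
exists w, time; split.
- exact: run.
- exists z; first exact: normal_equation_argmin.
  have -> : A *m w - y = A *m z - y + - (A *m (z - w)).
    by rewrite mulmxBr opprB [RHS]addrC addrA subrK.
  by apply: le_trans (ler_norm2D _ _) _; rewrite norm2N lerD2l.
- exact: sparse_zero_extend.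
(* The factors 3 and 2 obtained are below the required 5 and 4. *)
- rewrite yE in nz; apply: le_trans (sparse_recovery_error s0 sv nz wz) _.
  have t2 := norm2_ge0 (restrict_to (~: S) ft).
  have t1 : 0 <= norm1 (restrict_to (~: S) ft) / Num.sqrt #|S|%:R.
    by rewrite divr_ge0 ?norm1_ge0// sqrtr_ge0.
  lra.
- set l := ln_max1 _; have l1 : 1 <= l by exact: ln_max1_ge1.
  have lnN0 : 0 <= ln (N%:R : R) by rewrite ln_ge0// ler1n (leq_trans s0).
  have l4 : 1 <= l ^+ 4 by rewrite exprn_ege1.
  have s1 : 1 <= #|S|%:R :> R by rewrite ler1n.
  have lnl : ln (N%:R : R) ^+ 4 <= l ^+ 4.
    rewrite ler_pXn2r ?nnegrE//; last exact: le_trans l1.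
    by rewrite /l /ln_max1 le_max lexx orbT.
  have sl1 : 1 <= #|S|%:R * l ^+ 4 by rewrite mulr_ege1.
  (* One unit comes from rounding m, the other from the extra row; both are absorbed because s l^4
     >= 1. *)
  have m1 : m.+1%:R <= (C' + 2) * (#|S|%:R * l ^+ 4).
    rewrite -natr1; have := hm; rewrite ltr_norml => /andP[_ h].
    have : C' * #|S|%:R * ln (N%:R : R) ^+ 4 <= C' * #|S|%:R * l ^+ 4.
      by rewrite ler_wpM2l// mulr_ge0// ltW.
    lra.
  have k1 : k.+1%:R <= (K0 + 1) * L by rewrite -natr1; lra.
  have tk' : time%:R <= 22 * k.+1%:R * (m.+1%:R * #|S|%:R) :> R.
    by rewrite -!natrM ler_nat.
  apply: le_trans tk' _.
  have h1 : k.+1%:R * (m.+1%:R * #|S|%:R) <=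
     (K0 + 1) * L * ((C' + 2) * (#|S|%:R * l ^+ 4) * #|S|%:R).
    by rewrite ler_pM// ?mulr_ge0// ler_wpM2r.
  lra.
Qed.
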